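(* Let $G$ be a finite simple graph with $m \geq 1$ edges. Then $$\min(s^+(G), s^-(G)) \geq \frac{\operatorname{surp}(G)^2}{m}.$$
   Context: For a finite simple graph $G$ with adjacency matrix eigenvalues $\lambda_1 \geq \cdots \geq \lambda_n$, $s^+(G) = \sum_{i:\lambda_i \geq 0} \lambda_i^2$ and $s^-(G) = \sum_{i:\lambda_i \leq 0} \lambda_i^2$. The maxcut $\operatorname{mc}(G)$ is the maximum number of edges of a bipartite subgraph of $G$, and the surplus is $\operatorname{surp}(G) = \operatorname{mc}(G) - m/2$. *)

(* Defs.v *)
From mathcomp Require Import all_boot all_order all_algebra.
From mathcomp Require Import polyrcf.

Set Implicit Arguments.
Unset Strict Implicit.
Unset Printing Implicit Defensive.

Import Order.TTheory GRing.Theory Num.Theory.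
Local Open Scope ring_scope.

(* A simple graph on the vertex set T is a symmetric irreflexive relation
   e : rel T, and its edges are unordered pairs of adjacent vertices. *)
Definition edges (T : finType) (e : rel T) : {set {set T}} :=
  [set [set p.1; p.2] | p : T * T & e p.1 p.2].

Definition bipartite (T : finType) (H : {set {set T}}) : bool :=
  [exists S : {set T}, [forall f in H, (#|f :&: S| == 1%N) && (#|f :\: S| == 1%N)]].

(* Isolated vertices do not affect bipartiteness, so the subgraphs of e are
   represented by their sets of edges. *)
Definition maxcut (T : finType) (e : rel T) : nat :=
  \max_(H : {set {set T}} | (H \subset edges e) && bipartite H) #|H|.

Definition adj_matrix (R : nzRingType) (T : finType) (e : rel T) : 'M[R]_#|T| :=
  \matrix_(i, j) (e (enum_val i) (enum_val j))%:R.

(* The eigenvalues in R, repeated according to their multiplicity as roots of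
   the characteristic polynomial.  [rootsR p] lists the distinct roots of p. *)
Definition eigenvalues (R : rcfType) (n : nat) (A : 'M[R]_n) : seq R :=
  flatten [seq nseq (mup x (char_poly A)) x | x <- rootsR (char_poly A)].

Section Graph.
Variables (R : rcfType) (T : finType) (e : rel T).

Definition splus : R :=
  \sum_(x <- eigenvalues (adj_matrix R e) | 0 <= x) x ^+ 2.

Definition sminus : R :=
  \sum_(x <- eigenvalues (adj_matrix R e) | x <= 0) x ^+ 2.

Definition surplus : R := (maxcut e)%:R - #|edges e|%:R / 2.

End Graph.

Arguments splus R {T} e.
Arguments sminus R {T} e.
Arguments surplus R {T} e.

(* Main.v *)
(* Split the adjacency matrix as A = P - N into its positive and negative
   parts, and let D be the diagonal +-1 matrix of a maximum cut.  Entrywise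
   squaring does not change A, so tr(ADAD) = 2m - 4 mc = - 4 surp.  Since
   tr(PDPD) and tr(NDND) are nonnegative, 4 surp <= 2 tr(PDND), and
   Cauchy-Schwarz bounds the right-hand side by 2 sqrt(s+ s-).  As surp >= 0
   and s+ + s- = tr(A^2) = 2m, it follows that
   surp^2 <= s+ s- / 4 <= m min(s+, s-) / 2. *)
Require Import Defs.
From mathcomp Require Import all_boot all_order all_algebra.
From mathcomp Require Import polyrcf complex ring lra.

Set Implicit Arguments.
Unset Strict Implicit.
Unset Printing Implicit Defensive.

Import Order.TTheory GRing.Theory Num.Theory.
Local Open Scope ring_scope.

(** * Eigenvalues and the spectral theorem for real symmetric matrices *)

Lemma char_poly_similar (R : comUnitRingType) (n : nat) (P A : 'M[R]_n) :
  P \in unitmx -> char_poly (invmx P *m A *m P) = char_poly A.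
Proof.
move=> Punit; rewrite /char_poly.
have -> : char_poly_mx (invmx P *m A *m P) =
    map_mx polyC (invmx P) *m char_poly_mx A *m map_mx polyC P.
  rewrite /char_poly_mx !map_mxM /= mulmxBr mulmxBl; congr (_ - _).
  by rewrite mul_mx_scalar -scalemxAl -map_mxM mulVmx // map_mx1 scalemx1.
rewrite !det_mulmx mulrAC -det_mulmx -map_mxM mulVmx //.
by rewrite map_mx1 det1 mul1r.
Qed.

(** When the characteristic polynomial splits, the multiplicity of a root is its count in [s], so
    [eigenvalues A] is [s] grouped by value. *)
Lemma perm_eigenvalues (R : rcfType) (n : nat) (A : 'M[R]_n) (s : seq R) :
  char_poly A = \prod_(x <- s) ('X - x%:P) -> perm_eq (eigenvalues A) s.
Proof.
move=> charA; rewrite /eigenvalues charA.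
set p := \prod_(x <- s) _.
have p_neq0 : p != 0 by rewrite monic_neq0 ?monic_prod_XsubC.
apply: perm_trans (perm_count_undup s).
rewrite (eq_map (g := fun x => nseq (count_mem x s) x)); last first.
  by move=> x; rewrite mu_prod_XsubC.
apply/perm_flatten/perm_map/uniq_perm; rewrite ?undup_uniq ?uniq_roots //.
move=> x; rewrite -(roots_on_rootsR p_neq0) in_itv /=.
by rewrite mem_undup root_prod_XsubC.
Qed.

(* The weights are the squared moduli of the entries of the unitary hermitian
   matrix representing [B] in an orthonormal eigenbasis of [A]. *)
Lemma spectral_trace (R : rcfType) (n : nat) (A : 'M[R]_n) :
  A^T = A -> exists d : 'I_n -> R,
  [/\ char_poly A = \prod_i ('X - (d i)%:P), \tr (A *m A) = \sum_i d i ^+ 2 &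
      forall B : 'M[R]_n, B^T = B -> B *m B = 1%:M ->
        exists w : 'I_n -> 'I_n -> R,
        [/\ forall i j, 0 <= w i j, forall i j, w i j = w j i,
            forall i, \sum_j w i j = 1 &
            \tr (A *m B *m A *m B) = \sum_i \sum_j d i * d j * w i j]].
Proof.
(* The diagonalisation takes place over [R[i]], where [A] becomes hermitian. Its spectrum is real,
   so every identity descends to [R] by injectivity of [f]. *)
move=> symA; pose f : {rmorphism R -> R[i]} := real_complex R.
have realf m (M : 'M[R]_m) : map_mx f M \is a mxOver Num.real.
  by apply/mxOverP=> i j; rewrite mxE; apply/complex_realP; exists (M i j).
have hermf m (M : 'M[R]_m) : M^T = M -> map_mx f M \is hermsymmx.
  move=> symM; apply: realsym_hermsym (realf _ _).
  by apply/is_hermitianmxP; rewrite expr0 scale1r map_mx_id // map_trmx symM.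
have conjf m (M : 'M[R]_m) :
    M^T = M -> map_mx Num.conj (map_mx f M)^T = map_mx f M.
  by move=> /hermf /is_hermitianmxP; rewrite expr0 scale1r => <-.
have hermA := hermf _ _ symA.
have /orthomx_spectralP := hermitian_normalmx hermA.
set P := spectralmx _; set sp := spectral_diag _ => defA.
have Pu : P \is unitarymx := spectral_unitarymx _.
have sp_real : sp \is a mxOver Num.real := hermitian_spectral_diag_real hermA.
clearbody P sp.
have Punit := unitarymx_unit Pu.
pose d i := complex.Re (sp 0 i).
have spE i : sp 0 i = f (d i).
  by rewrite [RHS]RRe_real //; exact: (mxOverP sp_real).
exists d; split.
- apply: (map_poly_inj f).
  rewrite map_char_poly defA char_poly_similar //.
  rewrite char_poly_trig ?diag_mx_is_trig // rmorph_prod.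
  apply: eq_bigr => i _; rewrite rmorphB /= map_polyX map_polyC /=.
  by rewrite mxE eqxx mulr1n spE.
- apply: (fmorph_inj f); rewrite -trace_map_mx map_mxM defA.
  rewrite !mulmxA mulmxK // mxtrace_mulC !mulmxA mulmxV // mul1mx.
  rewrite rmorph_sum mul_diag_mx /mxtrace; apply: eq_bigr => i _.
  by rewrite !mxE eqxx mulr1n spE rmorphXn expr2.
move=> B symB BB.
pose W := P *m map_mx f B *m invmx P.
have WC i j : W j i = (W i j)^*.
  have : map_mx Num.conj W^T = W.
    rewrite /W invmx_unitary // !trmx_mul !map_mxM conjf //.
    by rewrite trmxCK mulmxA.
  by move/matrixP/(_ j i); rewrite !mxE.
pose w i j := complex.Re (`|W i j| ^+ 2).
have wE i j : f (w i j) = `|W i j| ^+ 2.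
  by rewrite [LHS]RRe_real // ger0_real // exprn_ge0.
have WW : W *m W = 1%:M.
  rewrite /W !mulmxA mulmxKV // -(mulmxA P) -map_mxM BB map_mx1 mulmx1.
  exact: mulmxV.
exists w; split.
- by move=> i j; rewrite -ler0c [X in 0 <= X]wE exprn_ge0.
- by move=> i j; rewrite /w WC norm_conjC.
(* As [W] is hermitian, the row sum is the diagonal entry of [W *m W = 1%:M]. *)
- move=> i; apply: (fmorph_inj f); rewrite rmorph_sum rmorph1.
  have := congr1 (fun M : 'M_n => M i i) WW; rewrite !mxE eqxx mulr1n => <-.
  by apply: eq_bigr => j _; rewrite wE (WC i j) normCK.
- apply: (fmorph_inj f); rewrite -trace_map_mx !map_mxM.
  have -> : \tr (map_mx f A *m map_mx f B *m map_mx f A *m map_mx f B) =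
      \tr (diag_mx sp *m W *m (diag_mx sp *m W)).
    by rewrite defA /W -!mulmxA [LHS]mxtrace_mulC -!mulmxA.
  clearbody W; rewrite !mul_diag_mx /mxtrace rmorph_sum; apply: eq_bigr => i _.
  rewrite mxE rmorph_sum; apply: eq_bigr => j _.
  by rewrite !mxE !rmorphM wE !spE (WC i j) normCK mulrACA.
Qed.

(** * Cauchy-Schwarz for a quadratic form with symmetric stochastic weights *)

Section WeightedQuadraticForm.
Variables (R : realFieldType) (I : finType) (d : I -> R) (w : I -> I -> R).
Hypotheses (w_ge0 : forall i j, 0 <= w i j) (wC : forall i j, w i j = w j i).
Hypothesis sum_w : forall i, \sum_j w i j = 1.

Let sump : R := \sum_(i | 0 <= d i) d i ^+ 2.
Let sumn : R := \sum_(i | d i <= 0) d i ^+ 2.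
Let p i : R := Num.max (d i) 0.
Let n i : R := Num.max (- d i) 0.

Let sumpE : sump = \sum_i p i ^+ 2.
Proof.
rewrite /sump big_mkcond; apply: eq_bigr => i _; rewrite /p.
by case: leP => //; rewrite expr0n.
Qed.

Let sumnE : sumn = \sum_i n i ^+ 2.
Proof.
rewrite /sumn big_mkcond; apply: eq_bigr => i _; rewrite /n.
case: (leP (d i) 0) => di; first by rewrite max_l ?sqrrN ?oppr_ge0.
by rewrite max_r ?expr0n // oppr_le0 ltW.
Qed.

(** Indices with [d i = 0] occur in both sums but contribute nothing. *)
Lemma weighted_sum_sqr_nonneg_nonpos : sump + sumn = \sum_i d i ^+ 2.
Proof.
rewrite sumpE sumnE -big_split; apply: eq_bigr => i _ /=.
rewrite /p /n; have [d_ge0|/ltW d_le0] := leP 0 (d i).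
  by rewrite max_r ?oppr_le0 // expr0n addr0.
by rewrite max_l ?oppr_ge0 // expr0n sqrrN add0r.
Qed.

(** Expand [d = p - n]. The [p p] and [n n] terms are nonnegative, so the form is at least
    [- (2 * X)], where [X] collects the mixed terms. Being nonpositive, it has square at most
    [4 * X ^+ 2], and Cauchy-Schwarz bounds [X ^+ 2]. *)
Lemma weighted_quadratic_form_bound :
  \sum_i \sum_j d i * d j * w i j <= 0 ->
  (\sum_i \sum_j d i * d j * w i j) ^+ 2 <= 4 * sump * sumn.
Proof.
pose X := \sum_i \sum_j p i * n j * w i j.
have p_ge0 i : 0 <= p i by rewrite le_max lexx orbT.
have n_ge0 i : 0 <= n i by rewrite le_max lexx orbT.
have dE i : d i = p i - n i.
  rewrite /p /n; have [d_ge0|/ltW d_le0] := leP 0 (d i).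
    by rewrite max_r ?oppr_le0 // subr0.
  by rewrite max_l ?oppr_ge0 // opprK add0r.
have X_ge0 : 0 <= X.
  by do 2![apply: sumr_ge0 => ? _]; rewrite !mulr_ge0.
(* Cauchy-Schwarz for X, in the form of a nonnegative binary form. *)
have form_ge0 a b : 0 <= a ^+ 2 * sump - 2 * a * b * X + b ^+ 2 * sumn.
  have -> : a ^+ 2 * sump - 2 * a * b * X + b ^+ 2 * sumn =
      \sum_i \sum_j (a * p i - b * n j) ^+ 2 * w i j.
    have -> : sump = \sum_i \sum_j p i ^+ 2 * w i j.
      by rewrite sumpE; apply: eq_bigr => i _; rewrite -mulr_sumr sum_w mulr1.
    (* Here the column sums of [w] are needed; by symmetry they are 1 as well. *)
    have -> : sumn = \sum_i \sum_j n j ^+ 2 * w i j.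
      rewrite sumnE exchange_big; apply: eq_bigr => i _ /=.
      by rewrite -mulr_sumr; under eq_bigr do rewrite wC; rewrite sum_w mulr1.
    rewrite !mulr_sumr -sumrB -big_split; apply: eq_bigr => i _ /=.
    rewrite !mulr_sumr -sumrB -big_split; apply: eq_bigr => j _ /=.
    ring.
  by do 2![apply: sumr_ge0 => ? _]; rewrite mulr_ge0 // sqr_ge0.
have sump_ge0 : 0 <= sump by apply: sumr_ge0 => ? _; rewrite sqr_ge0.
have sumn_ge0 : 0 <= sumn by apply: sumr_ge0 => ? _; rewrite sqr_ge0.
have X2_le : X ^+ 2 <= sump * sumn.
  (* At [(X, sump)] and [(sumn, X)] the form equals [sump], respectively [sumn], times
     [sump * sumn - X ^+ 2]. Adding the two leaves only the positive factor [sump + sumn] to cancel,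
     even if one summand is zero. If both vanish, the value at [(1, 1)] is [- 2 * X], which forces
     [X = 0]. *)
  have [s_gt0|s_le0] := ltP 0 (sump + sumn).
    rewrite -subr_ge0 -(pmulr_rge0 _ s_gt0).
    by have := form_ge0 X sump; have := form_ge0 sumn X; lra.
  have -> : X = 0 by have := form_ge0 1 1; lra.
  by rewrite expr0n mulr_ge0.
have form_ge : - (2 * X) <= \sum_i \sum_j d i * d j * w i j.
  have XC : X = \sum_i \sum_j n i * p j * w i j.
    rewrite /X exchange_big; apply: eq_bigr => i _; apply: eq_bigr => j _.
    by rewrite wC (mulrC (p j)).
  rewrite mulr_natl mulr2n {2}XC opprD -!sumrN -big_split.
  apply: ler_sum => i _ /=; rewrite -!sumrN -big_split.
  apply: ler_sum => j _ /=; rewrite !dE -subr_ge0.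
  have -> : (p i - n i) * (p j - n j) * w i j -
      (- (p i * n j * w i j) - n i * p j * w i j) =
      p i * p j * w i j + n i * n j * w i j by ring.
  by rewrite addr_ge0 // !mulr_ge0.
move=> form_le0; nra.
Qed.

End WeightedQuadraticForm.

(** * Edges as unordered pairs *)

Lemma set2_eq (T : finType) (a b u v : T) :
  a != b ->
  ([set u; v] == [set a; b]) = ((u, v) == (a, b)) || ((u, v) == (b, a)).
Proof.
move=> neq_ab; apply/eqP/orP => [/setP eq_uv|[]/eqP[-> ->]//]; last first.
  by rewrite setUC.
have := eq_uv v; have := eq_uv u; rewrite !inE !eqxx orbT /=.
move=> /esym/orP[]/eqP eq_u /esym/orP[]/eqP eq_v; rewrite eq_u eq_v;
  [ | by left | by right | ].
- have := eq_uv b; rewrite eq_u eq_v !inE eqxx orbT orbb eq_sym.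
  by rewrite (negbTE neq_ab).
- by have := eq_uv a; rewrite eq_u eq_v !inE eqxx orbb (negbTE neq_ab).
Qed.

(** Handshake count: the fibre of [(u, v) -> [set u; v]] over an edge has exactly two elements,
    since there are no loops. *)
Lemma sum_adjacency (T : finType) (e : rel T) :
  symmetric e -> irreflexive e ->
  (\sum_u \sum_v e u v = 2 * #|edges e|)%N.
Proof.
move=> e_sym e_irr.
rewrite pair_bigA /= -big_mkcond /=.
rewrite (partition_big_imset (fun q : T * T => [set q.1; q.2])) /=.
rewrite mulnC -sum_nat_const; apply: eq_big => [f|f /imsetP[[a b]]].
  apply/imsetP/imsetP=> -[q eq ->]; exists q => //.
    by rewrite inE.
  by rewrite inE in eq.
rewrite unfold_in /= => eab ->.
have neq_ab : a != b by apply: contraTneq eab => ->; rewrite e_irr.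
rewrite sum1_card -[RHS](_ : #|[set (a, b); (b, a)]| = 2%N); last first.
  by rewrite cards2 -pair_eqE /= (negbTE neq_ab).
apply: eq_card => -[u v]; rewrite !inE.
rewrite [LHS]unfold_in /= set2_eq // unfold_in /=.
by apply/andb_idl => /orP[]/eqP[-> ->] //; rewrite e_sym.
Qed.

(** Translates the cardinality test in [bipartite] into the condition defining a cut. *)
Lemma card_set2_split (T : finType) (S : {set T}) (u v : T) : u != v ->
  (#|[set u; v] :&: S| == 1%N) && (#|[set u; v] :\: S| == 1%N) =
  ((u \in S) != (v \in S)).
Proof.
move=> neq_uv.
have cardI : #|[set u; v] :&: S| = ((u \in S) + (v \in S))%N.
  rewrite -sum1_card (eq_bigl (mem [set x in [:: u; v] | x \in S])); last first.
    by move=> x; rewrite !inE.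
  rewrite big_mkcond /= (bigD1 u) //= (bigD1 v) ?(eq_sym v) //= big1.
    by rewrite !inE !eqxx ?orbT /=; case: (u \in S); case: (v \in S).
  by move=> x; rewrite !inE => /andP[/negbTE-> /negbTE->].
by rewrite cardsD cardI cards2 neq_uv; case: (u \in S); case: (v \in S).
Qed.

(** * Cuts, their quadratic form, and nonnegativity of the surplus *)

Section Cut.
Variables (T : finType) (e : rel T).
Hypotheses (e_sym : symmetric e) (e_irr : irreflexive e).

(** Being itself a graph relation, the cut can be counted by [edges] and [sum_adjacency]. *)
Definition cut_rel (S : {set T}) : rel T :=
  [rel u v | e u v && ((u \in S) != (v \in S))].

Lemma cut_rel_sym S : symmetric (cut_rel S).
Proof. by move=> u v; rewrite /cut_rel /= e_sym eq_sym. Qed.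

Lemma cut_rel_irr S : irreflexive (cut_rel S).
Proof. by move=> u; rewrite /cut_rel /= e_irr. Qed.

Lemma maxcut_max S : (#|edges (cut_rel S)| <= maxcut e)%N.
Proof.
apply: (@leq_bigmax_cond _ _ (fun H : {set {set T}} => #|H|)).
apply/andP; split.
  apply/subsetP => f /imsetP[q]; rewrite inE => /andP[eq _] ->.
  by apply/imsetP; exists q; rewrite ?inE.
apply/existsP; exists S; apply/forallP => f; apply/implyP.
move=> /imsetP[[u v]]; rewrite inE /= => /andP[euv cut_uv] ->.
by rewrite card_set2_split //; apply: contraTneq euv => ->; rewrite e_irr.
Qed.

(** A largest bipartite edge set lies inside the full cut of its own bipartition, which is no larger
    by maximality. *)
Lemma maxcut_attained : exists S, maxcut e = #|edges (cut_rel S)|.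
Proof.
have [|H /andP[sHe /existsP[S /forallP bipH]] maxH] :=
    @eq_bigmax_cond _
      (fun H : {set {set T}} => (H \subset edges e) && bipartite H)
      (fun H => #|H|).
  (* The empty edge set is bipartite, so the maximum ranges over a nonempty family. *)
  apply/card_gt0P; exists set0; rewrite unfold_in /= sub0set /=.
  by apply/existsP; exists set0; apply/forallP => f; rewrite inE.
exists S; apply/eqP; rewrite eqn_leq maxcut_max andbT /maxcut maxH.
apply/subset_leq_card/subsetP => f fH.
have /imsetP[[u v]] := subsetP sHe f fH; rewrite inE /= => euv deff.
have := implyP (bipH f) fH; rewrite deff card_set2_split; last first.
  by apply: contraTneq euv => ->; rewrite e_irr.
by move=> cut_uv; apply/imsetP; exists (u, v); rewrite ?inE /cut_rel /= ?euv.
Qed.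

Variable R : numDomainType.

Definition cut_sign (S : {set T}) (u : T) : R := (-1) ^+ (u \in S).

(** The quadratic form of the adjacency matrix at the sign vector of [S]. *)
Definition cut_form (S : {set T}) : R :=
  \sum_u \sum_v (e u v)%:R * cut_sign S u * cut_sign S v.

(** An adjacent ordered pair contributes 1, or -1 if it is cut, so each term is the [e] indicator
    minus twice the [cut_rel] indicator; both are summed by the handshake count. *)
Lemma cut_formE S :
  cut_form S = 2 * #|edges e|%:R - 4 * #|edges (cut_rel S)|%:R.
Proof.
have := sum_adjacency (cut_rel_sym S) (cut_rel_irr S).
have := sum_adjacency e_sym e_irr.
move=> /(congr1 (fun k => k%:R : R)); rewrite natrM => <-.
move=> /(congr1 (fun k => k%:R : R)); rewrite natrM => eq_cut.
rewrite (natrM _ 2 2 : 4 = 2 * 2 :> R) -mulrA -eq_cut.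
rewrite !natr_sum mulr_sumr -sumrB.
apply: eq_bigr => u _; rewrite !natr_sum mulr_sumr -sumrB.
apply: eq_bigr => v _; rewrite /cut_sign /cut_rel /=.
case: (e u v); case: (u \in S); case: (v \in S) => /=;
  by rewrite ?expr0 ?expr1; ring.
Qed.

(* Averaged over all [S], the form vanishes, since toggling [u] in [S] changes
   the sign of the [(u, v)] term. *)
Lemma sum_cut_form : \sum_S cut_form S = 0.
Proof.
rewrite exchange_big big1 // => u _; rewrite exchange_big big1 // => v _ /=.
case: (boolP (e u v)) => [euv|_]; last first.
  by rewrite big1 // => S _; rewrite !mul0r.
have neq_uv : v != u by apply: contraTneq euv => ->; rewrite e_irr.
pose toggle (S : {set T}) := [set x | (x \in S) (+) (x == u)].
have toggleK : involutive toggle.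
  by move=> S; apply/setP=> x; rewrite !inE addbK.
set s := \sum_S _; suff : s = - s.
  by move/eqP; rewrite -addr_eq0 -mulr2n mulrn_eq0 => /eqP.
rewrite {1}/s (reindex_inj (inv_inj toggleK)) -sumrN; apply: eq_bigr => S _.
rewrite /cut_sign !inE eqxx (negbTE neq_uv) addbT addbF.
by case: (u \in S) => /=; ring.
Qed.

End Cut.

(** A maximum cut minimises [cut_form], and the sum over all [S] is zero, so the minimum is
    nonpositive. Its value is -4 times the surplus. *)
Lemma maxcut_form (T : finType) (e : rel T) (R : realFieldType) :
  symmetric e -> irreflexive e ->
  exists2 S, cut_form e R S = 2 * #|edges e|%:R - 4 * (maxcut e)%:R
           & cut_form e R S <= 0.
Proof.
move=> e_sym e_irr; have [S maxS] := maxcut_attained e_irr.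
exists S; first by rewrite cut_formE // maxS.
rewrite leNgt; apply/negP => form_gt0.
have := sum_cut_form e_irr R; apply/eqP; rewrite gt_eqF //.
apply: (@lt_le_trans _ _ (\sum_(S' : {set T}) cut_form e R S)).
  by rewrite sumr_const pmulrn_lgt0 //; apply/card_gt0P; exists set0.
apply: ler_sum => S' _; rewrite !cut_formE // lerD2l lerN2.
by rewrite ler_wpM2l ?ler0n // ler_nat -maxS maxcut_max.
Qed.

(** * Traces of products of adjacency and sign matrices *)

Lemma sum_enum_val2 (V : nmodType) (T : finType) (F : T -> T -> V) :
  \sum_(i < #|T|) \sum_(j < #|T|) F (enum_val i) (enum_val j) =
  \sum_u \sum_v F u v.
Proof.
rewrite [RHS]big_enum_val /=; apply: eq_bigr => i _.
by rewrite [RHS]big_enum_val.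
Qed.

Section AdjacencyMatrix.
Variables (T : finType) (e : rel T) (R : nzRingType).
Hypothesis e_sym : symmetric e.

Lemma tr_adj_matrix : (adj_matrix R e)^T = adj_matrix R e.
Proof. by apply/matrixP=> i j; rewrite !mxE e_sym. Qed.

Lemma trace_adj_matrix_sqr :
  \tr (adj_matrix R e *m adj_matrix R e) = \sum_u \sum_v (e u v)%:R.
Proof.
rewrite -(sum_enum_val2 (fun u v => (e u v)%:R)); apply: eq_bigr => i _.
rewrite mxE; apply: eq_bigr => j _.
by rewrite !mxE (e_sym (enum_val j)) -natrM mulnb andbb.
Qed.

Definition sign_mx (S : {set T}) : 'M[R]_#|T| :=
  diag_mx (\row_i (-1) ^+ (enum_val i \in S)).

Lemma sign_mx_sqr S : sign_mx S *m sign_mx S = 1%:M.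
Proof.
rewrite /sign_mx mulmx_diag; apply/matrixP=> i j; rewrite !mxE.
by rewrite -signr_addb addbb.
Qed.

End AdjacencyMatrix.

(** Each term contains an adjacency entry times its transpose; by symmetry this is the square of a
    0/1 entry, hence the entry itself. *)
Lemma trace_sign_adj_matrix (T : finType) (e : rel T) (R : numDomainType) S :
  symmetric e ->
  \tr (adj_matrix R e *m sign_mx R S *m adj_matrix R e *m sign_mx R S) =
  cut_form e R S.
Proof.
move=> e_sym; rewrite /cut_form -sum_enum_val2; apply: eq_bigr => i _.
rewrite -(mulmxA _ (adj_matrix R e)) mxE; apply: eq_bigr => j _.
rewrite /sign_mx !mul_mx_diag !mxE (e_sym (enum_val j)).
by rewrite mulrACA -natrM mulnb andbb (mulrC (_ ^+ _)) mulrA.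
Qed.

Theorem theorem1p20 (R : rcfType) (T : finType) (e : rel T)
    (e_sym : symmetric e) (e_irr : irreflexive e)
    (m_ge1 : (1 <= #|edges e|)%N) :
  surplus R e ^+ 2 / #|edges e|%:R <= Num.min (splus R e) (sminus R e).
Proof.
have [d [charA trAA weights]] := spectral_trace (tr_adj_matrix R e_sym).
have [S formS form_le0] := maxcut_form R e_sym e_irr.
(* The sign matrix is a symmetric involution, as required of [B]. *)
have [w [w_ge0 wC sum_w trABAB]] :=
  weights (sign_mx R S) (tr_diag_mx _) (sign_mx_sqr R S).
rewrite trace_sign_adj_matrix // in trABAB.
have eigA :
    perm_eq (eigenvalues (adj_matrix R e)) [seq d i | i <- index_enum _].
  by apply: perm_eigenvalues; rewrite big_map charA.
have splusE : splus R e = \sum_(i | 0 <= d i) d i ^+ 2.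
  by rewrite /splus (perm_big _ eigA) big_map.
have sminusE : sminus R e = \sum_(i | d i <= 0) d i ^+ 2.
  by rewrite /sminus (perm_big _ eigA) big_map.
have sp_ge0 : 0 <= splus R e by apply: sumr_ge0 => x _; rewrite sqr_ge0.
have sm_ge0 : 0 <= sminus R e by apply: sumr_ge0 => x _; rewrite sqr_ge0.
have sumE : splus R e + sminus R e = 2 * #|edges e|%:R.
  rewrite splusE sminusE weighted_sum_sqr_nonneg_nonpos -trAA.
  rewrite trace_adj_matrix_sqr // -natrM -sum_adjacency // natr_sum.
  by apply: eq_bigr => u _; rewrite natr_sum.
have form_bound : cut_form e R S ^+ 2 <= 4 * splus R e * sminus R e.
  rewrite trABAB splusE sminusE; apply: weighted_quadratic_form_bound => //.
  by rewrite -trABAB.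
have m_gt0 : 0 < #|edges e|%:R :> R by rewrite ltr0n.
rewrite formS in form_bound.
(* The left side of [form_bound] is 16 times the squared surplus; divide by 4. *)
have surp_bound : 4 * surplus R e ^+ 2 <= splus R e * sminus R e.
  by rewrite /surplus; nra.
(* In each goal the other factor is at most twice the number of edges, by [sumE]. *)
by rewrite le_min !ler_pdivrMr //; apply/andP; split; nra.
Qed.
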